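(* Let $k$ be an algebraically closed field of characteristic $p\ge 3$ and let $(\mathfrak{u},[p])$ be a finite-dimensional unipotent restricted Lie algebra over $k$. Then $\mathbb{E}(2,\mathfrak{u})$ is connected.
   Context: A restricted Lie algebra $(\mathfrak{g},[p])$ over a field $k$ of characteristic $p$ is a Lie algebra with a $p$-map $x\mapsto x^{[p]}$ in the usual sense of Jacobson. A restricted Lie algebra $(\mathfrak{u},[p])$ is called unipotent if there is $n\in\mathbb{N}_0$ such that $x^{[p]^n}=0$ for all $x\in\mathfrak{u}$, where $x^{[p]^n}$ denotes the $n$-fold iterate of the $p$-map. Let $\mathrm{Gr}_2(\mathfrak{g})$ be the Grassmannian of two-dimensional subspaces of the vector space $\mathfrak{g}$. Define $$\mathbb{E}(2,\mathfrak{g}):=\{\mathfrak{e}\in \mathrm{Gr}_2(\mathfrak{g}) : [\mathfrak{e},\mathfrak{e}]=(0),\ x^{[p]}=0 \text{ for all } x\in\mathfrak{e}\},$$ the set of two-dimensional elementary abelian $p$-subalgebras. It is a Zariski closed subset of $\mathrm{Gr}_2(\mathfrak{g})$ and carries the Zariski (subspace) topology. The empty space is regarded as connected. *)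

(* Defs.v *)
From HB Require Import structures.
From mathcomp Require Import all_boot all_order all_algebra.
From mathcomp Require Import boolp classical_sets topology.
From mathcomp Require Import -(notations) mpoly.

Set Implicit Arguments.
Unset Strict Implicit.
Unset Printing Implicit Defensive.

Import GRing.Theory.
Local Open Scope ring_scope.
Local Open Scope classical_set_scope.

Section RestrictedLie.
Variables (k : fieldType) (V : lmodType k).

Record is_lie_bracket (br : V -> V -> V) : Prop := IsLieBracket {
  brDZl : forall (a : k) x y z, br (a *: x + y) z = a *: br x z + br y z;
  brDZr : forall (a : k) x y z, br x (a *: y + z) = a *: br x y + br x z;
  brxx : forall x, br x x = 0;
  br_jacobi : forall x y z,
    br x (br y z) + br y (br z x) + br z (br x y) = 0
}.

(* A polynomial in t with coefficients in V is encoded by its sequence of     *)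
(* coefficients nat -> V; this is the operator ad(t x + y) on V[t].           *)
Definition ad_pencil (br : V -> V -> V) (x y : V) (c : nat -> V) : nat -> V :=
  fun i => br y (c i) + (if i is j.+1 then br x (c j) else 0).

(* ad(t x + y)^(p-1) (x) = \sum_(1 <= i < p) i s_i(x, y) t^(i-1).             *)
Definition jacobson_s (p : nat) (br : V -> V -> V) (x y : V) (i : nat) : V :=
  (i%:R : k)^-1 *:
    iter p.-1 (ad_pencil br x y) (fun j => if j is 0 then x else 0) i.-1.

Record is_pmap (p : nat) (br : V -> V -> V) (pm : V -> V) : Prop := IsPmap {
  pmap_ad : forall x y, br (pm x) y = iter p (br x) y;
  pmapZ : forall (a : k) x, pm (a *: x) = a ^+ p *: pm x;
  pmapD : forall x y,
    pm (x + y) = pm x + pm y + \sum_(1 <= i < p) jacobson_s p br x y i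
}.

Definition is_restricted_lie (p : nat) (br : V -> V -> V) (pm : V -> V) : Prop :=
  is_lie_bracket br /\ is_pmap p br pm.

Definition unipotent (pm : V -> V) : Prop :=
  exists n : nat, forall x, iter n pm x = 0.

End RestrictedLie.

Section Grassmannian.
Variables (k : fieldType) (V : vectType k).

Record Gr2 : Type := MkGr2 { gr2_val :> {vspace V}; _ : \dim gr2_val == 2 }.
HB.instance Definition _ := [isSub for gr2_val].
HB.instance Definition _ := [Choice of Gr2 by <:].

(* Pluecker coordinates x_i y_j - x_j y_i of the span of x and y, with respect*)
(* to a fixed basis of V. They are redundant (an alternating matrix rather    *)
(* than its entries i < j): this embeds P(Lambda^2 V) as a linear subspace of *)
(* the projective space of matrices, hence yields the same topology.          *)
Definition plucker_mx (x y : V) : 'M[k]_(\dim {:V}) :=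
  \matrix_(i, j) (coord (vbasis {:V}) i x * coord (vbasis {:V}) j y
                - coord (vbasis {:V}) j x * coord (vbasis {:V}) i y).

(* Another basis of e, or of V, rescales this vector, or changes it by a      *)
(* linear automorphism of the ambient space, so that the Zariski topology     *)
(* below does not depend on these choices.                                    *)
Definition plucker (e : Gr2) : 'I_(\dim {:V} * \dim {:V}) -> k :=
  fun i => mxvec (plucker_mx (vbasis e)`_0 (vbasis e)`_1) 0 i.

Definition plucker_poly := mpoly (\dim {:V} * \dim {:V}) k.

Definition homogeneous (f : plucker_poly) : Prop :=
  exists d : nat, f \is ishomog1 d mdeg.

Definition zero_locus (S : set plucker_poly) : set Gr2 :=
  [set e | forall f, S f -> meval (plucker e) f = 0].

Definition zariski_closed (A : set Gr2) : Prop :=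
  exists2 S : set plucker_poly, S `<=` homogeneous & A = zero_locus S.

Definition zariski_open (A : set Gr2) : Prop := zariski_closed (~` A).

Lemma zariski_openT : zariski_open setT.
Proof.
exists [set 1].
  by move=> _ ->; exists 0%N; apply: dhomog1.
apply/seteqP; split=> e /=; first by move=> /(_ I).
by move=> /(_ _ erefl); rewrite meval1 => /eqP; rewrite oner_eq0.
Qed.

Lemma zariski_openI : setI_closed zariski_open.
Proof.
move=> A B [S hS eA] [T hT eB].
exists [set f | exists2 g, S g & exists2 h, T h & f = g * h].
  move=> _ [g Sg [h Th ->]]; have [[d hg] [d' hh]] := (hS _ Sg, hT _ Th).
  by exists (d + d')%N; apply: dhomogM.
rewrite setCI eA eB; apply/seteqP; split=> e /=.
  move=> h _ [f Sf [g Tg ->]]; rewrite mevalM.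
  by case: h => [/(_ _ Sf)|/(_ _ Tg)] ->; rewrite ?mul0r ?mulr0.
move=> h; have [hSe|/existsNP [f /not_implyP[Sf /eqP nf]]] :=
  pselect (zero_locus S e); first by left.
right=> g Tg; have := h _ (ex_intro2 _ _ f Sf (ex_intro2 _ _ g Tg erefl)).
by rewrite mevalM => /eqP; rewrite mulf_eq0 (negPf nf) => /eqP.
Qed.

Lemma zariski_open_bigU (I : Type) (A : I -> set Gr2) :
  (forall i, zariski_open (A i)) -> zariski_open (\bigcup_i A i).
Proof.
move=> oA; exists [set f | homogeneous f /\
    exists i, forall e, (~` A i) e -> meval (plucker e) f = 0].
  by move=> f [].
rewrite setC_bigcup; apply/seteqP; split=> e /=.
  by move=> h f [_ [i]]; apply; apply: h.
move=> h i _; have [S hS eS] := oA i; rewrite eS => f Sf.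
apply: h; split; [exact: hS | exists i => e' nA].
by have : (~` A i) e' := nA; rewrite eS; apply.
Qed.

HB.instance Definition _ := isOpenTopological.Build Gr2
  zariski_openT zariski_openI zariski_open_bigU.

Definition E2 (br : V -> V -> V) (pm : V -> V) : set Gr2 :=
  [set e : Gr2 | (forall x y, x \in gr2_val e -> y \in gr2_val e -> br x y = 0)
        /\ (forall x, x \in gr2_val e -> pm x = 0)].

End Grassmannian.

(* Main.v *)
From HB Require Import structures.
Require Import Defs.
From mathcomp Require Import all_boot all_algebra.
From mathcomp Require Import topology.
From mathcomp Require Import boolp classical_sets ring.
From mathcomp Require Import -(notations) mpoly.

(** Write F for the p-map.  Unipotence makes every ad x nilpotent, since a
    power of ad x is the adjoint of an iterate of F at x; so Engel's theorem
    gives a central z <> 0 with F z = 0.  If <a, b> in E(2, u) does not contain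
    z, the planes <a, (1 - t) b + t z> join it to <a, z> inside E(2, u).  It
    remains to join <x, z> to <y, z> when F x = F y = 0 and x, y are not
    multiples of z, that is, to join x to y by polynomial curves in the
    nullcone of F which avoid the line <z>; a polynomial curve in the
    Grassmannian has a connected image ([connected_curve]) because the field is
    infinite.

    The joining is proved by induction up the upper central series
    ([all_null_mod_linked]).  The induction replaces u by a quotient u / I, but
    everything is written in u, modulo I.  So let I be an ideal stable under F
    and z central modulo I, not in I, with F z in I; x and y satisfy
    F x, F y in I and are not in J = I + <z>.  Let C and C2 be the preimages
    of the first and second centers of u / I.  Since p >= 3, the bracket terms
    in Jacobson's formula for F (x + w) lie in I when w is in C2
    ([pmD_mod]), so translation by C2 is harmless: F (x + w) = F x + F w
    modulo I.

    - If some w in C2, not in J, has F w in I, then x is a multiple of w modulo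
      J or is joined to w by the line (1 - t) x + t w
      ([linked_null_center2]).

    - Otherwise F induces an injective p-semilinear map from C2 / J to C / I.
      Now x is not in C2, so C <> u and C2 <> C by Engel; a count of dimensions
      shows that C2 = C + <v> for any v in C2 outside C, and that F maps C2
      onto C modulo I ([pm_center2_onto]).  Hence each x with F x in C has a
      translate x + l, l in C2, with F (x + l) in I, and l is unique modulo J.
      So the problem for (I, z) has the same solutions as the one for the
      larger ideal C and the vector v, which is settled by induction.  Only the
      curves have to be lifted: l depends on x through p-th roots, and it
      becomes polynomial after the substitution t = s ^ p ([lift_polycurve],
      [lift_linked]).  That substitution fixes the end points 0 and 1. *)

Set Implicit Arguments.
Unset Strict Implicit.
Unset Printing Implicit Defensive.

Import GRing.Theory.

(** * Roots and subspaces *)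
Section Preliminaries.
Local Open Scope ring_scope.

Lemma exists_root (k : closedFieldType) n (a : k) :
  (0 < n)%N -> exists b, b ^+ n = a.
Proof.
case: n => // n n0.
have [b Eb] := solve_monicpoly (fun i => if i is 0%N then a else 0) n0.
exists b; rewrite Eb big_ord_recl expr0 mulr1 big1 ?addr0 // => i _.
by rewrite mul0r.
Qed.

Lemma exists_maximal_subspace (k : fieldType) (V : vectType k)
    (P : {vspace V} -> Prop) (W : {vspace V}) : P W ->
  exists2 M, P M & forall M', P M' -> (\dim M' <= \dim M)%N.
Proof.
move=> PW; pose Q n := `[< exists2 M, P M & \dim M = n >].
have exQ : exists n, Q n by exists (\dim W); apply/asboolP; exists W.
have bQ n : Q n -> (n <= \dim {:V})%N.
  by move=> /asboolP[M _ <-]; apply/dimvS/subvf.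
have [n /asboolP[M PM <-] maxM] := ex_maxnP exQ bQ.
by exists M => // M' PM'; apply: maxM; apply/asboolP; exists M'.
Qed.

Lemma dimv_add_line (k : fieldType) (V : vectType k) (W : {vspace V}) x :
  x \notin W -> \dim (W + <[x]>) = (\dim W).+1.
Proof.
move=> xW; rewrite dimv_disjoint_sum ?dim_vline.
  by case: eqP xW => [->|_]; rewrite ?mem0v ?addn1.
apply/eqP; rewrite -subv0; apply/subvP => y; rewrite memv_cap memv0.
move=> /andP[yW /vlineP[a ya]]; rewrite ya scaler_eq0; apply: contraNT xW.
rewrite negb_or => /andP[a0 _].
by rewrite -[x](scalerK a0) memvZ // -ya.
Qed.

Lemma vspace_of_pred (k : fieldType) (V : vectType k) (P : V -> Prop) :
  P 0 -> (forall a x y, P x -> P y -> P (a *: x + y)) ->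
  exists W : {vspace V}, forall x, x \in W <-> P x.
Proof.
move=> P0 PD; pose Q (W : {vspace V}) := forall x, x \in W -> P x.
have Q0 : Q 0%VS by move=> x; rewrite memv0 => /eqP->.
have [W QW maxW] := exists_maximal_subspace Q0.
exists W => x; split=> [/QW//|Px]; apply: contrapT => /negP xW.
have /maxW : Q (W + <[x]>)%VS; last by rewrite dimv_add_line // ltnn.
move=> y /memv_addP[w wW [_ /vlineP[a ->] ->]].
by rewrite addrC; apply: PD => //; apply: QW.
Qed.

End Preliminaries.

(** * Polynomial curves in a vector space *)
Section PolynomialCurves.
Local Open Scope ring_scope.
Variable k : fieldType.

(** The maps t |-> \sum_i t ^ i *: v_i, generated by a Horner scheme: the
    closure properties below are then proved by structural induction, without
    handling coefficients. *)
Inductive polycurve (V : lmodType k) : (k -> V) -> Prop :=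
| polycurve_cst v : polycurve (fun=> v)
| polycurveD c d : polycurve c -> polycurve d -> polycurve (fun t => c t + d t)
| polycurveX c : polycurve c -> polycurve (fun t => t *: c t).

Lemma eq_polycurve (V : lmodType k) (c d : k -> V) :
  c =1 d -> polycurve c -> polycurve d.
Proof. by move=> /funext->. Qed.

Lemma polycurveXn (V : lmodType k) n (c : k -> V) :
  polycurve c -> polycurve (fun t => t ^+ n *: c t).
Proof.
move=> hc; elim: n => [|n IH]; last first.
  by apply: eq_polycurve (polycurveX IH) => t; rewrite scalerA exprS.
by apply: eq_polycurve hc => t; rewrite scale1r.
Qed.

Lemma polycurve_linear (V W : lmodType k) (f : V -> W) (c : k -> V) :
  linear f -> polycurve c -> polycurve (fun t => f (c t)).
Proof.
move=> lf; pose F : {linear V -> W} :=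
  HB.pack f (GRing.isLinear.Build _ _ _ _ f lf).
rewrite -[f]/(F : V -> W); elim=> {c} [v|c d _ IHc _ IHd|c _ IHc].
- exact: polycurve_cst.
- by apply: eq_polycurve (polycurveD IHc IHd) => t; rewrite linearD.
- by apply: eq_polycurve (polycurveX IHc) => t; rewrite linearZ.
Qed.

Lemma polycurve_sum (V : lmodType k) (I : Type) (r : seq I) (c : I -> k -> V) :
  (forall i, polycurve (c i)) -> polycurve (fun t => \sum_(i <- r) c i t).
Proof.
move=> hc; elim: r => [|i r IH].
  by apply: eq_polycurve (polycurve_cst 0) => t; rewrite big_nil.
by apply: eq_polycurve (polycurveD (hc i) IH) => t; rewrite big_cons.
Qed.

(** Used with n = p, to make p-th roots of t available as polynomials in the
    new parameter. *)
Lemma polycurve_pow (V : lmodType k) n (c : k -> V) :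
  polycurve c -> polycurve (fun s => c (s ^+ n)).
Proof.
elim=> {c} [v|c d _ IHc _ IHd|c _ IHc]; first exact: polycurve_cst.
  exact: polycurveD.
exact: polycurveXn.
Qed.

Lemma polycurve_form (V : lmodType k) (f : {scalar V}) (c : k -> V) :
  polycurve c -> exists P : {poly k}, forall t, f (c t) = P.[t].
Proof.
elim=> {c} [v|c d _ [P hP] _ [Q hQ]|c _ [P hP]].
- by exists (f v)%:P => t; rewrite hornerC.
- by exists (P + Q) => t; rewrite linearD hornerD hP hQ.
- by exists ('X * P) => t; rewrite linearZ /= hP hornerM hornerX.
Qed.

End PolynomialCurves.

(** * Central series and the p-map *)
Section RestrictedLieAlgebra.
Local Open Scope ring_scope.
Variables (k : closedFieldType) (p : nat) (u : vectType k).
Variables (br : u -> u -> u) (pm : u -> u).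
Hypothesis p_ge3 : (3 <= p)%N.
Hypothesis restr_u : is_restricted_lie p br pm.

Let lie_br : is_lie_bracket br := proj1 restr_u.
Let pmap_pm : is_pmap p br pm := proj2 restr_u.
Let p_gt0 : (0 < p)%N. Proof. exact: leq_trans p_ge3. Qed.

Lemma br_linear_r x : linear (br x).
Proof. by move=> a y z; rewrite (brDZr lie_br). Qed.

Lemma brDl x y z : br (x + y) z = br x z + br y z.
Proof. by have := brDZl lie_br 1 x y z; rewrite !scale1r. Qed.

Lemma brDr x y z : br x (y + z) = br x y + br x z.
Proof. by have := brDZr lie_br 1 x y z; rewrite !scale1r. Qed.

Lemma br0l x : br 0 x = 0.
Proof. by apply: (addrI (br 0 x)); rewrite -brDl !addr0. Qed.

Lemma br0r x : br x 0 = 0.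
Proof. by apply: (addrI (br x 0)); rewrite -brDr !addr0. Qed.

Lemma brZl a x y : br (a *: x) y = a *: br x y.
Proof. by have := brDZl lie_br a x 0 y; rewrite addr0 br0l addr0. Qed.

Lemma brZr a x y : br x (a *: y) = a *: br x y.
Proof. by have := brDZr lie_br a x y 0; rewrite addr0 br0r addr0. Qed.

Lemma brC x y : br x y = - br y x.
Proof.
apply/eqP; rewrite -addr_eq0; apply/eqP.
have := brxx lie_br (x + y).
by rewrite brDl !brDr !(brxx lie_br) add0r addr0.
Qed.

Lemma br_derivation x y z : br x (br y z) = br (br x y) z + br y (br x z).
Proof.
have /eqP := br_jacobi lie_br x y z.
rewrite (brC z (br x y)) (brC z x) -scaleN1r brZr scaleN1r subr_eq0 => /eqP <-.
by rewrite addrNK.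
Qed.

Lemma pm0 : pm 0 = 0.
Proof.
have := pmapZ pmap_pm 0 0.
by rewrite scale0r expr0n -leqn0 leqNgt p_gt0 scale0r.
Qed.

Lemma polycurve_br c d :
  polycurve c -> polycurve d -> polycurve (fun t => br (c t) (d t)).
Proof.
move=> hc hd; elim: hc => {c} [v|c e _ IHc _ IHe|c _ IHc].
- exact: polycurve_linear (br_linear_r v) hd.
- by apply: eq_polycurve (polycurveD IHc IHe) => t; rewrite brDl.
- by apply: eq_polycurve (polycurveX IHc) => t; rewrite brZl.
Qed.

Lemma polycurve_jacobson c d i :
  polycurve c -> polycurve d ->
  polycurve (fun t => jacobson_s p br (c t) (d t) i).
Proof.
move=> hc hd; apply: polycurve_linear => [b x y|].
  by rewrite scalerDr !scalerA mulrC.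
move: i.-1; elim: p.-1 => [|n IH] [|j] /=.
- by [].
- exact: polycurve_cst.
- apply: eq_polycurve (polycurve_br hd (IH 0%N)) => t.
  by rewrite /ad_pencil addr0.
- exact: polycurveD (polycurve_br hd (IH j.+1)) (polycurve_br hc (IH j)).
Qed.

(** Jacobson's formula is polynomial in both arguments, so the p-map preserves
    polynomial curves although it is not additive. *)
Lemma polycurve_pm c : polycurve c -> polycurve (fun t => pm (c t)).
Proof.
elim=> {c} [v|c d hc IHc hd IHd|c _ IHc]; first exact: polycurve_cst.
  have hs := polycurve_sum (index_iota 1 p)
               (fun i => polycurve_jacobson i hc hd).
  apply: eq_polycurve (polycurveD (polycurveD IHc IHd) hs) => t.
  by rewrite (pmapD pmap_pm).
by apply: eq_polycurve (polycurveXn p IHc) => t; rewrite (pmapZ pmap_pm).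
Qed.

Definition lie_ideal (I : {vspace u}) := forall y x, x \in I -> br y x \in I.

Lemma exists_center_mod (I : {vspace u}) :
  exists C : {vspace u}, forall x, x \in C <-> forall y, br y x \in I.
Proof.
apply: vspace_of_pred => [y|a x z hx hz y]; first by rewrite br0r mem0v.
by rewrite (brDZr lie_br) memvD ?memvZ.
Qed.

(** The preimage of the center of u / I. *)
Definition center_mod I : {vspace u} := sval (cid (exists_center_mod I)).

Lemma center_modP I x : x \in center_mod I <-> forall y, br y x \in I.
Proof. exact: (svalP (cid (exists_center_mod I)) x). Qed.

Lemma br_center I x y : x \in center_mod I -> br x y \in I.
Proof. by move=> /center_modP/(_ y); rewrite brC memvN. Qed.

Lemma sub_center I : lie_ideal I -> (I <= center_mod I)%VS.
Proof.
by move=> iI; apply/subvP => x xI; apply/center_modP => y; apply: iI.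
Qed.

Lemma lie_ideal_center I : lie_ideal I -> lie_ideal (center_mod I).
Proof.
by move=> iI y x /center_modP hx; apply: (subvP (sub_center iI)); apply: hx.
Qed.

Lemma iter_ad_in I n x y :
  lie_ideal I -> br x y \in I -> iter n.+1 (br x) y \in I.
Proof. by move=> iI xy; elim: n => // n IH; rewrite iterS; apply: iI. Qed.

(** ad (x^[p]) = (ad x)^p and ad x already maps u into I. *)
Lemma pm_center I x :
  lie_ideal I -> x \in center_mod I -> pm x \in center_mod I.
Proof.
move=> iI hx; apply/center_modP => y; rewrite brC memvN (pmap_ad pmap_pm).
by rewrite -(prednK p_gt0) iter_ad_in ?br_center.
Qed.

(** ad x maps u into [center_mod I], hence (ad x)^2 maps u into I. *)
Lemma pm_center2 I x :
  lie_ideal I -> x \in center_mod (center_mod I) -> pm x \in center_mod I.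
Proof.
move=> iI hx; apply/center_modP => y; rewrite brC memvN (pmap_ad pmap_pm).
have -> : p = p.-2.+2 by case: p p_ge3 => [|[]].
rewrite iterSr iter_ad_in //; apply: (proj1 (center_modP _ _)).
exact: br_center.
Qed.

(** The operator ad (t x + y) sends A[t] into B[t] as soon as every ad v sends
    A into B. *)
Lemma ad_pencil_in (A B : {vspace u}) x y c :
  (forall v w, w \in A -> br v w \in B) ->
  (forall i, c i \in A) -> forall i, ad_pencil br x y c i \in B.
Proof.
move=> hAB hc [|i]; rewrite /ad_pencil ?addr0; first exact: hAB.
by rewrite memvD //; apply: hAB.
Qed.

(** The coefficients of ad (t x + y)^(p-1) (x) are brackets of length p >= 3 in
    x and y that start with [y, x].  This element is central modulo I, so one
    more bracket lands in I. *)
Lemma jacobson_center2_in I x y i : lie_ideal I ->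
  y \in center_mod (center_mod I) -> jacobson_s p br x y i \in I.
Proof.
move=> iI hy; rewrite memvZ //; have -> : p.-1 = p.-2.-1.+2.
  by case: p p_ge3 => [|[|[]]].
rewrite !iterSr; move: i.-1.
elim: p.-2.-1 => [|n IH] j /=; last exact: ad_pencil_in IH _.
have iC v w : w \in center_mod I -> br v w \in I by move/center_modP.
apply: ad_pencil_in iC _ _ => {}j; rewrite /ad_pencil; case: j => [|[|j]].
- by rewrite addr0; apply: br_center.
(* The coefficient of t is [x, x]. *)
- by rewrite br0r (brxx lie_br) addr0 mem0v.
- by rewrite !br0r addr0 mem0v.
Qed.

Lemma pmD_mod I x y : lie_ideal I -> y \in center_mod (center_mod I) ->
  pm (x + y) - (pm x + pm y) \in I.
Proof.
move=> iI hy; rewrite (pmapD pmap_pm) addrC addKr.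
by apply: memv_suml => i _; apply: jacobson_center2_in.
Qed.

(** * Engel's theorem *)
Section Engel.
Hypothesis unip_u : unipotent pm.

Lemma iter_ad_pm n x y : iter (p ^ n) (br x) y = br (iter n pm x) y.
Proof.
elim: n => [|n IH] in x y *; first by rewrite expn0.
rewrite iterSr -IH expnS mulnC.
have -> : br (pm x) = iter p (br x).
  by apply/funext => z; rewrite (pmap_ad pmap_pm).
move: (p ^ n)%N => m; elim: m => //= m IHm in y *.
by rewrite -IHm mulSn iterD.
Qed.

Lemma ad_nilpotent x : exists n, forall y, iter n (br x) y = 0.
Proof.
by have [n hn] := unip_u; exists (p ^ n)%N => y; rewrite iter_ad_pm hn br0l.
Qed.

Lemma last_iterate (f : u -> u) (A : {vspace u}) v n :
  v \notin A -> iter n f v \in A ->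
  exists2 m, iter m f v \notin A & iter m.+1 f v \in A.
Proof.
move=> vA; elim: n => [vA'|n IH nA]; first by rewrite vA' in vA.
by have [/IH//|nA'] := boolP (iter n f v \in A); exists n.
Qed.

Definition normalizes (K A : {vspace u}) :=
  forall x y, x \in K -> y \in A -> br x y \in A.

(** The usual induction on the dimension of the subalgebra K.  Take a maximal
    proper subalgebra M.  The induction hypothesis for M acting on K / M gives
    x in K, not in M, which normalizes M, so K = M + <x>.  The vectors of B / A
    killed by M form a nonzero space stable under x, and x is nilpotent, so the
    last nonzero iterate of x on one of them is killed by K. *)
Lemma engel_subalgebra n (K A B : {vspace u}) :
  (\dim K <= n)%N -> normalizes K K -> normalizes K A -> normalizes K B ->
  (A <= B)%VS -> A != B ->
  exists2 v, v \in B & v \notin A /\ forall x, x \in K -> br x v \in A.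
Proof.
elim: n => [|n IH] in K A B * => dK KK KA KB sAB neAB.
  have /subvPn[v vB vA] : ~~ (B <= A)%VS.
    by apply: contra neAB => sBA; rewrite eqEsubv sAB.
  exists v => //; split=> // x; move: dK; rewrite leqn0 dimv_eq0 => /eqP->.
  by rewrite memv0 => /eqP->; rewrite br0l mem0v.
have [K0|K0] := eqVneq K 0%VS.
  by apply: IH => //; rewrite K0 dimv0.
pose P (M : {vspace u}) := [/\ normalizes M M, (M <= K)%VS & M != K].
have P0 : P 0%VS.
  split; [|exact: sub0v|by rewrite eq_sym].
  by move=> x y; rewrite !memv0 => /eqP-> /eqP->; rewrite br0l.
have [M [MM sMK neMK] maxM] := exists_maximal_subspace P0.
have dM : (\dim M <= n)%N.
  rewrite -ltnS; apply: leq_trans dK.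
  by rewrite (ltn_leqif (dimv_leqif_eq sMK)).
have sMKP := subvP sMK.
have MK : normalizes M K by move=> a b aM; apply: KK; apply: sMKP.
have [x xK [xM Mx]] := IH _ _ _ dM MM MM MK sMK neMK.
have [v vB [vA Mv]] : exists2 v, v \in B &
    v \notin A /\ forall x, x \in M -> br x v \in A.
  by apply: IH => // a b aM; [apply: KA|apply: KB]; apply: sMKP.
have defK : (M + <[x]>)%VS = K.
  have sMxK : (M + <[x]> <= K)%VS by rewrite subv_add sMK -memvE.
  apply/eqP/negPn/negP => neK.
  have /maxM : P (M + <[x]>)%VS.
    split=> // _ _ /memv_addP[a aM [_ /vlineP[s ->] ->]]
      /memv_addP[b bM [_ /vlineP[t ->] ->]].
    apply: (subvP (addvSl M <[x]>)).
    rewrite !(brDl, brDr, brZl, brZr) (brxx lie_br) !scaler0 addr0 (brC x b).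
    by rewrite !memvD ?memvZ ?memvN ?Mx ?MM.
  by rewrite dimv_add_line // ltnn.
have [m hm] := ad_nilpotent x.
have [j jA SjA] : exists2 j, iter j (br x) v \notin A &
    iter j.+1 (br x) v \in A.
  by apply: (@last_iterate _ _ _ m); rewrite // hm mem0v.
have jB : iter j (br x) v \in B by elim: (j) => //= i IHi; apply: KB.
have Mj y : y \in M -> br y (iter j (br x) v) \in A.
  elim: (j) y => [|i IHi] y yM; first exact: Mv.
  rewrite iterS br_derivation memvD //; first exact/IHi/Mx.
  by apply: KA => //; apply: IHi.
exists (iter j (br x) v) => //; split=> // y.
rewrite -defK => /memv_addP[a aM [_ /vlineP[s ->] ->]].
by rewrite brDl brZl memvD ?memvZ //; apply: Mj.
Qed.

Lemma engel (A : {vspace u}) : lie_ideal A -> A != fullv ->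
  exists2 v, v \notin A & v \in center_mod A.
Proof.
move=> iA neA.
have [|||||v _ [vA hv]] := @engel_subalgebra _ fullv A fullv (leqnn _) => //.
- by move=> x y _ _; rewrite memvf.
- by move=> x y _; apply: iA.
- by move=> x y _ _; rewrite memvf.
- exact: subvf.
by exists v => //; apply/center_modP => y; apply: hv; rewrite memvf.
Qed.

End Engel.

(** * Joining null vectors modulo an ideal *)
Lemma pmD_in I x y : lie_ideal I -> y \in center_mod (center_mod I) ->
  (pm (x + y) \in I) = (pm x + pm y \in I).
Proof.
by move=> iI hy; rewrite -(subrK (pm x + pm y) (pm (x + y))) rpredDl ?pmD_mod.
Qed.

Lemma pm_sum_mod I n (b : 'I_n -> k) (X : 'I_n -> u) : lie_ideal I ->
  (forall i, X i \in center_mod (center_mod I)) ->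
  pm (\sum_i b i *: X i) - \sum_i b i ^+ p *: pm (X i) \in I.
Proof.
move=> iI hX; set x := \sum_i _; set y := \sum_i _.
suff [] : x \in center_mod (center_mod I) /\ pm x - y \in I by [].
rewrite {}/x {}/y; elim/big_rec2: _ => [|i y x _ [hx hxy]].
  by rewrite pm0 subr0 !mem0v.
split; first by rewrite memvD ?memvZ.
have := memvD (pmD_mod (b i *: X i) iI hx) hxy.
by rewrite (pmapZ pmap_pm) opprD addrA addrA subrK opprD addrA.
Qed.

(** The data of the induction: I is a restricted ideal of u, and z spans a
    central line of u / I on which the p-map of u / I vanishes. *)
Record central_null (I : {vspace u}) (z : u) : Prop := CentralNull {
  cn_ideal : lie_ideal I;
  cn_pm : forall x, x \in I -> pm x \in I;
  cn_center : z \in center_mod I;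
  cn_notin : z \notin I;
  cn_pmz : pm z \in I }.

(** The class of x in u / I is killed by the p-map and is not on the line
    spanned by z: together with z it spans a plane of E(2, u / I) when
    [central_null] holds for I and z. *)
Definition null_mod (I : {vspace u}) z x :=
  pm x \in I /\ x \notin (I + <[z]>)%VS.

(** Two null vectors are linked when the planes that they span with z modulo I
    are joined by a chain of polynomial curves.  Rule [linked_scale] identifies
    the vectors that give the same plane. *)
Inductive linked (I : {vspace u}) (z : u) : u -> u -> Prop :=
| linked_curve c : polycurve c -> (forall t, null_mod I z (c t)) ->
    linked I z (c 0) (c 1)
| linked_scale a x y : a != 0 -> null_mod I z x -> null_mod I z y ->
    y - a *: x \in (I + <[z]>)%VS -> linked I z x y
| linked_sym x y : linked I z x y -> linked I z y x
| linked_trans x y w : linked I z x y -> linked I z y w -> linked I z x w.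

Lemma linked_null I z x y : linked I z x y -> null_mod I z x /\ null_mod I z y.
Proof. by elim=> // {x y} [x y _ [] | x y w _ [hx _] _ []]. Qed.

Lemma linked_eq_mod I z x y : null_mod I z x -> null_mod I z y ->
  y - x \in (I + <[z]>)%VS -> linked I z x y.
Proof.
move=> hx hy hxy.
by apply: (@linked_scale _ _ 1); rewrite ?oner_eq0 ?scale1r.
Qed.

Lemma polycurve_line (x y : u) : polycurve (fun t => (1 - t) *: x + t *: y).
Proof.
have := polycurveD (polycurve_cst x) (polycurveX (polycurve_cst (y - x))).
by apply: eq_polycurve => t; rewrite scalerBr scalerBl scale1r addrA addrAC.
Qed.

Lemma linked_line I z x y :
  (forall t, null_mod I z ((1 - t) *: x + t *: y)) -> linked I z x y.
Proof.
move=> /(linked_curve (polycurve_line x y)).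
by rewrite subr0 subrr !scale0r !scale1r addr0 add0r.
Qed.

Section CentralNull.
Variables (I : {vspace u}) (z : u).
Hypothesis cnIz : central_null I z.
Let iI := cn_ideal cnIz.
Local Notation C := (center_mod I).
Local Notation C2 := (center_mod (center_mod I)).
Local Notation J := (I + <[z]>)%VS.

Lemma sub_line_center : (J <= C)%VS.
Proof. by rewrite subv_add sub_center // -memvE (cn_center cnIz). Qed.

Lemma sub_center2 : (C <= C2)%VS.
Proof. exact/sub_center/lie_ideal_center. Qed.

Lemma linked_null_center2 w x : w \in C2 -> null_mod I z w -> null_mod I z x ->
  linked I z x w.
Proof.
move=> wC nw nx; have [xJ|xJ] := boolP (x \in (J + <[w]>)%VS).
  have /memv_addP[j jJ [_ /vlineP[a ->] defx]] := xJ.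
  apply: linked_sym; apply: (@linked_scale _ _ a) => //; last first.
    by rewrite defx addrK.
  by apply: contraNneq (proj2 nx) => a0; rewrite defx a0 scale0r addr0.
apply: linked_line => t; split.
  rewrite pmD_in ?memvZ // !(pmapZ pmap_pm).
  by rewrite memvD ?memvZ ?(proj1 nw) ?(proj1 nx).
have [/eqP|t1] := eqVneq (1 - t) 0.
  by rewrite subr_eq0 => /eqP<-; rewrite subrr scale0r add0r scale1r (proj2 nw).
apply: contra xJ => h; rewrite -[x](scalerK t1) memvZ //.
rewrite -[X in X \in _](addrK (t *: w)) memvB //.
  exact: (subvP (addvSl _ _)).
by apply: (subvP (addvSr _ _)); rewrite memvZ ?memv_line.
Qed.

(** From here on the p-map modulo I is injective on C2 / J.  In the opposite
    case, [linked_null_center2] applies. *)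
Hypothesis null_C2 : forall w, w \in C2 -> pm w \in I -> w \in J.

(** The p-map is p-semilinear modulo I on C2, and every coefficient a_i is the
    p-th power of some b_i: a relation between the images of the X_i is the
    image of \sum_i b_i *: X_i, which is then zero. *)
Lemma pm_center2_free n (X : n.-tuple u) (a : 'I_n -> k) : free X ->
  (<<X>> <= C2)%VS -> (<<X>> :&: J = 0)%VS ->
  \sum_i a i *: pm X`_i \in I -> forall i, a i = 0.
Proof.
move=> fX sX XJ ha i; pose b i := sval (cid (exists_root (a i) p_gt0)).
have bE j : b j ^+ p = a j by exact: svalP (cid (exists_root (a j) p_gt0)).
have inX (j : 'I_n) : X`_j \in <<X>>%VS.
  by rewrite memv_span // mem_nth ?size_tuple.
suff : \sum_j b j *: X`_j = 0.
  move: fX => /freeP fX /fX/(_ i) b0.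
  by rewrite -bE b0 expr0n -leqn0 leqNgt p_gt0.
have inXs : \sum_j b j *: X`_j \in <<X>>%VS.
  by apply: memv_suml => j _; rewrite memvZ.
apply/eqP; rewrite -memv0 -XJ memv_cap inXs; apply: null_C2.
  exact: (subvP sX).
have XC2 (j : 'I_n) : X`_j \in C2 by apply: (subvP sX).
have := pm_sum_mod b iI XC2; under [X in _ - X]eq_bigr do rewrite bE.
by move=> /memvD/(_ ha); rewrite subrK.
Qed.

(** The injection of C2 / J into C / I gives
    dim C2 - dim I - 1 <= dim C - dim I.  Since v shows that dim C < dim C2,
    both sides are equal. *)
Lemma pm_center2_onto v : v \in C2 -> v \notin C ->
  (C + <[v]>)%VS = C2 /\
  forall y, y \in C -> exists2 l, l \in C2 & pm l + y \in I.
Proof.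
move=> vC2 vC; pose D := (C2 :\: J)%VS; pose X := vbasis D.
have sDC2 : (D <= C2)%VS by exact: diffvSl.
have spX : <<X>>%VS = D by exact: span_basis (vbasisP D).
have DJ : (<<X>> :&: J = 0)%VS by rewrite spX capv_diff.
have fX : free X by exact: basis_free (vbasisP D).
have dimC2 : \dim C2 = ((\dim I).+1 + \dim D)%N.
  rewrite -(dimv_cap_compl C2 J) -(dimv_add_line (cn_notin cnIz)).
  by rewrite (capv_idPr (subv_trans sub_line_center sub_center2)).
have key a := pm_center2_free (a := a) fX; rewrite spX in key.
pose Y := map_tuple pm X.
have YE (i : 'I_(\dim D)) : Y`_i = pm X`_i.
  by rewrite (nth_map 0) // size_tuple.
have keyY (a : 'I_(\dim D) -> k) :
    \sum_i a i *: Y`_i \in I -> forall i, a i = 0.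
  move=> ha; apply: key => //; first by rewrite -spX.
  by move: ha; under eq_bigr do rewrite YE.
have fY : free Y by apply/freeP => a a0; apply: keyY; rewrite a0 mem0v.
have IY : (I :&: <<Y>> = 0)%VS.
  apply/eqP; rewrite -subv0; apply/subvP => y.
  rewrite memv_cap memv0 => /andP[yI].
  move=> /coord_span yE; rewrite yE in yI.
  by rewrite yE big1 // => i _; rewrite (keyY _ yI) scale0r.
have YC : (<<Y>> <= C)%VS.
  apply/span_subvP => _ /mapP[x xX ->]; apply: pm_center2 => //.
  by apply: (subvP sDC2); apply: vbasis_mem.
have sIYC : (I + <<Y>> <= C)%VS by rewrite subv_add sub_center.
have dimIY : \dim (I + <<Y>>) = (\dim I + \dim D)%N.
  by rewrite dimv_disjoint_sum // (eqP fY) size_tuple.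
have sCvC2 : (C + <[v]> <= C2)%VS by rewrite subv_add sub_center2 -memvE.
have dimCv := dimv_add_line vC.
have dimC : \dim C = (\dim I + \dim D)%N.
  apply/eqP; rewrite eqn_leq -{2}dimIY dimvS // andbT.
  by rewrite -ltnS -dimCv -addSn -dimC2 dimvS.
have defC : (I + <<Y>>)%VS = C.
  by apply/eqP; rewrite eqEdim sIYC dimIY dimC leqnn.
split; first by apply/eqP; rewrite eqEdim sCvC2 dimCv dimC dimC2 addSn leqnn.
move=> y yC; have : y \in (I + <<Y>>)%VS by rewrite defC.
move=> /memv_addP[i iI' [w /coord_span wE ->]].
pose b j := sval (cid (exists_root (- coord Y j w) p_gt0)).
have bE j : b j ^+ p = - coord Y j w.
  exact: svalP (cid (exists_root _ p_gt0)).
have XC2 (j : 'I_(\dim D)) : X`_j \in C2.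
  by apply: (subvP sDC2); apply: vbasis_mem; rewrite mem_nth ?size_tuple.
exists (\sum_j b j *: X`_j).
  by apply: memv_suml => j _; rewrite memvZ ?XC2.
have := pm_sum_mod b iI XC2; rewrite addrCA.
under [X in _ - X]eq_bigr do rewrite bE scaleNr -YE.
by rewrite sumrN opprK -wE => /(memvD iI').
Qed.

(** If the coefficient of t ^ i in G is - F(l_i) modulo I with l_i in C2, then
    F (\sum_i s ^ i *: l_i) is - G (s ^ p) modulo I by semilinearity.
    Projecting G to C puts its coefficients in C without changing its values. *)
Lemma lift_polycurve v G : v \in C2 -> v \notin C -> polycurve G ->
  (forall t, G t \in C) ->
  exists2 l, polycurve l & forall s, l s \in C2 /\ pm (l s) + G (s ^+ p) \in I.
Proof.
move=> vC2 vC hG GC; have [_ onto] := pm_center2_onto vC2 vC.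
suff [l hl lP] : exists2 l, polycurve l &
    forall s, l s \in C2 /\ pm (l s) + projv C (G (s ^+ p)) \in I.
  by exists l => // s; have := lP s; rewrite projv_id.
elim: hG {GC} => [w|c d _ [l hl lP] _ [m hm mP]|c _ [l hl lP]].
- have [l lC2 lP] := onto _ (memv_proj C w).
  by exists (fun=> l) => //; apply: polycurve_cst.
- exists (fun t => l t + m t) => [|s]; first exact: polycurveD.
  have [[lC lI] [mC mI]] := (lP s, mP s); split; first exact: memvD.
  rewrite linearD -[pm _](subrK (pm (l s) + pm (m s))) -addrA.
  by rewrite memvD ?pmD_mod // addrACA memvD.
- exists (fun t => t *: l t) => [|s]; first exact: polycurveX.
  have [lC lI] := lP s; split; first exact: memvZ.
  by rewrite (pmapZ pmap_pm) linearZ -scalerDr memvZ.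
Qed.

(** The hypotheses on x' and y' leave them only a freedom of J, as two null
    vectors modulo I that differ by an element of C2 differ by an element of
    J.  A curve c is lifted to s |-> c (s ^ p) + l s, with l given by
    [lift_polycurve] for the curve F (c t). *)
Lemma lift_linked v x y x' y' : v \in C2 -> v \notin C ->
  linked C v x y -> x' - x \in C2 -> y' - y \in C2 ->
  null_mod I z x' -> null_mod I z y' -> linked I z x' y'.
Proof.
move=> vC2 vC; have [defC2 onto] := pm_center2_onto vC2 vC.
have modC2 a b :
    null_mod I z a -> null_mod I z b -> b - a \in C2 -> linked I z a b.
  move=> na nb ab; apply: linked_eq_mod => //; apply: null_C2 => //.
  have := proj1 nb; rewrite -{1}(subrK a b) addrC pmD_in // rpredDl //.
  exact: (proj1 na).
have nullC2 a l :
    a \notin C2 -> l \in C2 -> pm a + pm l \in I -> null_mod I z (a + l).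
  move=> aC2 lC2 al; split; first by rewrite pmD_in.
  apply: contra aC2 => /(subvP (subv_trans sub_line_center sub_center2)).
  by rewrite rpredDr.
move=> lxy; elim: lxy x' y' => {x y}
  [c hc nc|a x y a0 nx ny xy|x y _ IH|x y w xy IHx _ IHy] x' y'.
- move=> hx hy nx' ny'.
  have ncC t : pm (c t) \in C by exact: (proj1 (nc t)).
  (* The p-map sends the curve c into C, so its image can be lifted. *)
  have [l hl lP] := lift_polycurve vC2 vC (polycurve_pm hc) ncC.
  pose d s := c (s ^+ p) + l s.
  have hd : polycurve d by apply: polycurveD hl; apply: polycurve_pow.
  have nd s : null_mod I z (d s).
    have [ls pls] := lP s; apply: nullC2 => //; last by rewrite addrC.
    by rewrite -defC2; exact: (proj2 (nc _)).
  have := linked_curve hd nd.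
  rewrite /d expr1n expr0n -leqn0 leqNgt p_gt0 /= => h.
  apply: linked_trans (linked_trans h _).
    apply: modC2 => //.
      by have := nd 0; rewrite /d expr0n -leqn0 leqNgt p_gt0.
    have [l0C _] := lP 0.
    by rewrite -addrA addrCA memvD // -memvN opprB.
  have [l1C _] := lP 1; apply: modC2 => //.
    by have := nd 1; rewrite /d expr1n.
  by rewrite opprD addrA memvB.
- move=> hx hy nx' ny'; apply: (@linked_scale _ _ a) => //.
  have hd : y' - a *: x' \in C2.
    have -> : y' - a *: x' = y' - y + (y - a *: x) - a *: (x' - x).
      by rewrite scalerBr opprB !addrA !subrK.
    by rewrite memvB ?memvZ // memvD // -defC2.
  apply: null_C2 => //.
  have := proj1 ny'; rewrite -{1}(subrK (a *: x') y') addrC pmD_in //.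
  by rewrite rpredDl // (pmapZ pmap_pm) memvZ // (proj1 nx').
- by move=> hx hy nx' ny'; apply: linked_sym; apply: IH.
- move=> hx hw nx' nw'; have [_ [pyC yC2]] := linked_null xy.
  have [l lC2 lP] := onto _ pyC.
  have ny' : null_mod I z (y + l).
    by apply: nullC2 => //; rewrite 1?addrC // -defC2.
  by apply: linked_trans (IHx _ _ hx _ nx' ny') (IHy _ _ _ hw ny' nw');
    rewrite addrC addKr.
Qed.

End CentralNull.

Hypothesis unip_u : unipotent pm.

(** Induction on the codimension of I, passing from (I, z) to (C, v) where C is
    [center_mod I]. *)
Lemma all_null_mod_linked I z x y : central_null I z ->
  null_mod I z x -> null_mod I z y -> linked I z x y.
Proof.
move: {2}(\dim {:u}) (leq_addl (\dim I) (\dim {:u})) => n.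
elim: n => [|n IH] in I z x y * => dimI cnIz nx ny.
  have /subvP sI : (fullv <= I)%VS.
    rewrite -(geq_leqif (dimv_leqif_sup (subvf I))).
    by rewrite -[X in (_ <= X)%N]addn0.
  by have := cn_notin cnIz; rewrite sI ?memvf.
have iI := cn_ideal cnIz.
pose C := center_mod I; pose C2 := center_mod C.
have [[w [wC2 nw]]|hnone] := pselect (exists w, w \in C2 /\ null_mod I z w).
  apply: linked_trans (linked_sym _); exact: (linked_null_center2 cnIz wC2 nw).
have null_C2 w : w \in C2 -> pm w \in I -> w \in (I + <[z]>)%VS.
  by move=> wC2 wI; apply: contra_notT hnone => wJ; exists w.
have notC2 a : null_mod I z a -> a \notin C2.
  by move=> na; apply/negP => aC2; apply: hnone; exists a.
have sCC2 := subvP (sub_center2 cnIz).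
have neC : C != fullv.
  by apply: contraNneq (notC2 x nx) => eC; rewrite sCC2 // -/C eC memvf.
have iC : lie_ideal C := lie_ideal_center iI.
have [v vC vC2] := engel unip_u iC neC.
have cnCv : central_null C v.
  by split=> // [a|]; [apply: pm_center|apply: pm_center2].
have [defC2 _] := pm_center2_onto cnIz null_C2 vC2 vC.
have nC a : null_mod I z a -> null_mod C v a.
  move=> na; split; last by rewrite defC2 notC2.
  exact/(subvP (sub_center iI))/(proj1 na).
have sub0 (a : u) : a - a \in C2 by rewrite subrr mem0v.
apply: (lift_linked cnIz null_C2 vC2 vC _ (sub0 x) (sub0 y) nx ny).
apply: IH (nC _ nx) (nC _ ny) => //.
have /dimvS := sub_line_center cnIz.
rewrite (dimv_add_line (cn_notin cnIz)) => dC.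
by apply: leq_trans dimI _; rewrite addnS -addSn leq_add2r.
Qed.

(** The center is stable under the p-map, so the last nonzero iterate of the
    p-map on a nonzero central vector is central and killed by the p-map. *)
Lemma exists_central_null : (0 < \dim {:u})%N -> exists z, central_null 0%VS z.
Proof.
move=> u0.
have i0 : lie_ideal 0%VS by move=> y x; rewrite !memv0 => /eqP->; rewrite br0r.
have [|v v0 vC] := engel unip_u i0.
  by apply: contraTneq u0 => <-; rewrite dimv0.
have [n hn] := unip_u.
have [|m m0 Sm0] := @last_iterate pm 0%VS v n v0; first by rewrite hn mem0v.
exists (iter m pm v); split=> // [x|].
  by rewrite !memv0 => /eqP->; rewrite pm0.
by elim: (m) => // j; apply: pm_center.
Qed.

End RestrictedLieAlgebra.

(** * Polynomial curves in the Grassmannian *)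
Section GrassmannianCurves.
Local Open Scope ring_scope.
Local Open Scope classical_set_scope.

Lemma meval_homogeneousZ (k : fieldType) (V : vectType k) (f : plucker_poly V) :
  homogeneous f -> exists n : nat, forall (d : k) v w,
  (forall i, v i = d * w i) -> meval v f = d ^+ n * meval w f.
Proof.
move=> [n /dhomogP hf]; exists n => d v w hvw.
rewrite !mevalE mulr_sumr; apply: eq_big_seq => m mf.
rewrite mulrCA; congr (_ * _); under eq_bigr do rewrite hvw exprMn.
by rewrite big_split /= prodrXr -mdegE hf.
Qed.

Lemma meval_polynomial (k : fieldType) n (f : mpoly n k)
    (P : 'I_n -> {poly k}) :
  exists Q : {poly k}, forall t, meval (fun i => (P i).[t]) f = Q.[t].
Proof.
exists (\sum_(m <- msupp f) mcoeff m f *: \prod_i P i ^+ m i) => t.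
rewrite mevalE horner_sum; apply: eq_bigr => m _.
by rewrite hornerZ horner_prod; under [in RHS]eq_bigr do rewrite horner_exp.
Qed.

Variables (k : closedFieldType) (V : vectType k).

Lemma free_pair (a b : V) : free [:: a; b] = (a \notin <[b]>%VS) && (b != 0).
Proof.
by rewrite free_cons span_seq1 free_cons span_nil memv0 nil_free andbT.
Qed.

Lemma free_pair_eq0 (a b : V) s t :
  free [:: a; b] -> s *: a + t *: b = 0 -> s = 0 /\ t = 0.
Proof.
rewrite free_pair => /andP[ab b0] /eqP st0.
have s0 : s = 0.
  apply: contraNeq ab => s0; apply/vlineP; exists (- (s^-1 * t)).
  move: st0; rewrite addr_eq0 => /eqP sab.
  by rewrite -[a](scalerK s0) sab scalerN scalerA scaleNr.
split=> //; apply/eqP; move: st0.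
by rewrite s0 scale0r add0r scaler_eq0 (negPf b0) orbF.
Qed.

(** The scalar is the determinant of the change of basis. *)
Lemma plucker_basis (e : Gr2 V) (a b : V) :
  a \in gr2_val e -> b \in gr2_val e -> free [:: a; b] -> exists2 d, d != 0 &
  forall i, mxvec (plucker_mx a b) 0 i = d * plucker e i.
Proof.
rewrite /plucker; case: e => W /= /eqP dimW; set X := vbasis W.
have sX : size X = 2%N by rewrite size_tuple.
have defW : W = (<[X`_0]> + <[X`_1]>)%VS.
  have := span_basis (vbasisP W); rewrite -/X.
  by case: (tval X) sX => [|? [|? []]] //= _ <-; rewrite span_cons span_seq1.
set v := X`_0; set w := X`_1.
have inW x : x \in W -> exists s t, x = s *: v + t *: w.
  rewrite defW => /memv_addP[_ /vlineP[s ->] [_ /vlineP[t ->] ->]].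
  by exists s, t.
move=> /inW[s [t defa]] /inW[s' [t' defb]] fab.
exists (s * t' - t * s') => [|i].
  apply/eqP => det0.
  have [|t'0 t0] := @free_pair_eq0 a b t' (- t) fab.
    rewrite defa defb scaleNr !scalerDr !scalerA opprD addrACA.
    rewrite -!scalerBl (mulrC t') det0 scale0r add0r (mulrC t') subrr.
    by rewrite scale0r.
  have [|s'0 s0] := @free_pair_eq0 a b s' (- s) fab.
    rewrite defa defb scaleNr !scalerDr !scalerA opprD addrACA.
    rewrite -!scalerBl (mulrC s') subrr scale0r add0r.
    by rewrite (mulrC s') -opprB det0 oppr0 scale0r.
  move: fab; rewrite defa defb -(opprK t) t0 -(opprK s) s0 !oppr0.
  by rewrite !scale0r addr0 free_pair mem0v.
case/mxvec_indexP: i => i j.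
rewrite !mxvecE !mxE defa defb !linearD !linearZ /=.
ring.
Qed.

(** The closed subsets of the curve are cut out by polynomials in t, because a
    homogeneous equation in Pluecker coordinates does not see the choice of the
    basis.  If the curve had a proper nonempty clopen part, there would be two
    nonzero polynomials whose product vanishes on the whole infinite field. *)
Lemma connected_curve (g : k -> Gr2 V) (a b : k -> V) :
  polycurve a -> polycurve b ->
  (forall t, [/\ a t \in gr2_val (g t), b t \in gr2_val (g t)
             & free [:: a t; b t]]) ->
  connected (range g).
Proof.
move=> ha hb gab.
have [P hP] : exists P : 'I_(\dim {:V} * \dim {:V}) -> {poly k},
    forall t i, mxvec (plucker_mx (a t) (b t)) 0 i = (P i).[t].
  suff /choice[P hP] : forall i, exists Q : {poly k},
      forall t, mxvec (plucker_mx (a t) (b t)) 0 i = Q.[t] by exists P.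
  move=> l; case/mxvec_indexP: l => i j.
  have [ai hai] := polycurve_form (coord (vbasis {:V}) i) ha.
  have [aj haj] := polycurve_form (coord (vbasis {:V}) j) ha.
  have [bi hbi] := polycurve_form (coord (vbasis {:V}) i) hb.
  have [bj hbj] := polycurve_form (coord (vbasis {:V}) j) hb.
  exists (ai * bj - aj * bi) => t.
  by rewrite mxvecE mxE hai haj hbi hbj !hornerE.
have eqn f : homogeneous f ->
    exists Q : {poly k}, forall t,
      (meval (plucker (g t)) f == 0) = (Q.[t] == 0).
  move=> hf; have [Q hQ] := meval_polynomial f P; exists Q => t.
  have [n hn] := meval_homogeneousZ hf.
  have [at_ bt ft] := gab t.
  have [d d0 hd] := plucker_basis at_ bt ft.
  have -> : Q.[t] = d ^+ n * meval (plucker (g t)) f.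
    by rewrite -hQ; apply: hn => i; rewrite -hP hd.
  by rewrite mulf_eq0 expf_eq0 (negPf d0) andbF.
(* A closed set that misses a point of the curve is met only at the roots of a
   nonzero polynomial. *)
have avoid (D : set (Gr2 V)) t : closed D -> ~ D (g t) ->
    exists2 Q : {poly k}, Q.[t] != 0 & forall s, D (g s) -> Q.[s] == 0.
  move=> /closed_openC cD nD.
  have [S hS] : zariski_closed D by rewrite -[D]setCK.
  move=> defD; move: nD.
  rewrite {1}defD => /existsNP[f /not_implyP[Sf /eqP nf]].
  have [Q hQ] := eqn f (hS f Sf); exists Q => [|s]; first by rewrite -hQ.
  by rewrite defD => /(_ f Sf) h; rewrite -hQ h.
move=> B [e0 Be0] [U oU defBU] [D cD defBD].
apply/seteqP; split=> [e|_ [t1 _ <-]]; first by rewrite defBD => -[].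
apply: contrapT => nB; have [t0 Ut0] : exists t, U (g t).
  by move: Be0; rewrite defBU => -[[t _ <-] Ut]; exists t.
have [|Q Q0 QU] := avoid (~` U) t0 (open_closedC oU); first by apply.
have [|Q' Q'1 QD] := avoid D t1 cD.
  by move=> Dt1; apply: nB; rewrite defBD; split=> //; exists t1.
have /closed_nonrootP[t] : Q * Q' != 0.
  by rewrite mulf_neq0 //; [apply: contraNneq Q0|apply: contraNneq Q'1] => ->;
    rewrite horner0.
rewrite rootM negb_or => /andP[/negP Qt /negP Q't].
have [Ut|Ut] := pselect (U (g t)); last by apply: Qt; apply: QU.
have : B (g t) by rewrite defBU; split=> //; exists t.
by rewrite defBD => -[_ /QD].
Qed.

Lemma exists_Gr2 (a b : V) : free [:: a; b] ->
  exists e : Gr2 V, gr2_val e = (<[a]> + <[b]>)%VS.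
Proof.
move=> fab; have dab : \dim <<[:: a; b]>> == 2%N by rewrite (eqP fab).
by exists (MkGr2 dab); rewrite /= span_cons span_seq1.
Qed.

Lemma gr2_complete_basis (e : Gr2 V) b : b \in gr2_val e -> b != 0 ->
  exists a, [/\ a \in gr2_val e, free [:: a; b]
             & gr2_val e = (<[a]> + <[b]>)%VS].
Proof.
case: e => W /= /eqP dimW bW b0.
have /subvPn[a aW ab] : ~~ (W <= <[b]>)%VS.
  by apply/negP => /dimvS; rewrite dimW dim_vline b0.
exists a; split=> //; first by rewrite free_pair ab.
apply/esym/eqP; rewrite eqEdim subv_add -!memvE aW bW addvC.
by rewrite dimv_add_line ?dim_vline ?b0 ?dimW.
Qed.

End GrassmannianCurves.

(** * Connecting elementary abelian planes *)
Section ConnectednessOfE2.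
Local Open Scope ring_scope.
Local Open Scope classical_set_scope.
Variables (k : closedFieldType) (p : nat) (u : vectType k).
Variables (br : u -> u -> u) (pm : u -> u).
Hypotheses (p_ge3 : (3 <= p)%N) (restr_u : is_restricted_lie p br pm).

(** Every bracket in Jacobson's formula contains [y, x]. *)
Lemma pmD_commuting x y : br x y = 0 -> pm (x + y) = pm x + pm y.
Proof.
move=> xy0; rewrite (pmapD (proj2 restr_u)) big1 ?addr0 // => i _.
suff : jacobson_s p br x y i \in 0%VS by rewrite memv0 => /eqP.
have -> : jacobson_s p br x y i =
    (i%:R : k)^-1 *: iter p.-2.+1 (ad_pencil br x y)
    (fun j => if j is 0%N then x else 0) i.-1.
  by case: p p_ge3 => [|[]].
rewrite memvZ // iterSr; move: i.-1; elim: p.-2 => [|n IH] j /=.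
  rewrite memv0 /ad_pencil (brC restr_u y); case: j => [|[|j]].
  - by rewrite xy0 oppr0 addr0.
  - by rewrite (br0l restr_u) oppr0 (brxx (proj1 restr_u)) addr0.
  - by rewrite (br0l restr_u) (br0r restr_u) oppr0 addr0.
apply: ad_pencil_in IH _ => v w; rewrite !memv0 => /eqP->.
by rewrite (br0r restr_u).
Qed.

Lemma E2_pair (e : Gr2 u) a b : gr2_val e = (<[a]> + <[b]>)%VS ->
  br a b = 0 -> pm a = 0 -> pm b = 0 -> E2 br pm e.
Proof.
move=> defe ab a0 b0; have ba : br b a = 0 by rewrite (brC restr_u) ab oppr0.
have [lie_br pmap_pm] := restr_u.
split=> [x y|x];
  rewrite defe => /memv_addP[_ /vlineP[s ->] [_ /vlineP[t ->] ->]].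
  move=> /memv_addP[_ /vlineP[s' ->] [_ /vlineP[t' ->] ->]].
  rewrite !(brDl restr_u, brDr restr_u, brZl restr_u, brZr restr_u) ab ba.
  by rewrite !(brxx lie_br) !scaler0 !addr0.
rewrite pmD_commuting; last first.
  by rewrite (brZl restr_u) (brZr restr_u) ab !scaler0.
by rewrite !(pmapZ pmap_pm) a0 b0 !scaler0 addr0.
Qed.

(** [component_linked] uses a fixed vector b = z, and
    [component_through_center] uses a moving vector that reaches z. *)
Lemma component_pencil_curve (a b : k -> u) (e e' : Gr2 u) :
  polycurve a -> polycurve b ->
  (forall t, [/\ free [:: a t; b t], br (a t) (b t) = 0, pm (a t) = 0
             & pm (b t) = 0]) ->
  gr2_val e = (<[a 0%R]> + <[b 0%R]>)%VS ->
  gr2_val e' = (<[a 1%R]> + <[b 1%R]>)%VS ->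
  connected_component (E2 br pm) e e'.
Proof.
move=> ha hb hab defe defe'.
have /choice[g gE] : forall t, exists e : Gr2 u,
    gr2_val e = (<[a t]> + <[b t]>)%VS.
  by move=> t; apply: exists_Gr2; have [] := hab t.
have eg : e = g 0 by apply: val_inj; rewrite /= gE.
have eg' : e' = g 1 by apply: val_inj; rewrite /= gE.
apply: (@connected_component_max _ _ (range g)); last by exists 1.
- by exists 0.
- move=> _ [t _ <-]; have [_ h1 h2 h3] := hab t.
  exact: E2_pair (gE t) h1 h2 h3.
- apply: (connected_curve ha hb) => t; have [ft _ _ _] := hab t.
  split=> //; rewrite gE.
    exact: (subvP (addvSl _ _)) (memv_line _).
  exact: (subvP (addvSr _ _)) (memv_line _).
Qed.

Variable z : u.
Hypothesis cnz : central_null restr_u 0%VS z.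

Lemma central_pm : pm z = 0.
Proof. by apply/eqP; rewrite -memv0 (cn_pmz cnz). Qed.

Lemma central_br x : br x z = 0.
Proof.
apply/eqP; rewrite -memv0.
exact: (proj1 (center_modP restr_u _ _)) (cn_center cnz) _.
Qed.

Lemma null_mod0 x : null_mod pm 0%VS z x -> pm x = 0 /\ free [:: x; z].
Proof.
rewrite /null_mod add0v memv0 => -[/eqP-> xz]; split=> //.
by rewrite free_pair xz -memv0 (cn_notin cnz).
Qed.

Lemma component_linked x y : linked pm 0%VS z x y -> forall e e' : Gr2 u,
  gr2_val e = (<[x]> + <[z]>)%VS -> gr2_val e' = (<[y]> + <[z]>)%VS ->
  connected_component (E2 br pm) e e'.
Proof.
elim=> {x y} [c hc nc|a x y a0 nx ny xy|x y _ IH|x y w xy IHx _ IHy]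
  e e' defe defe'.
- apply: (component_pencil_curve hc (polycurve_cst z)) => // t.
  by have [ct fct] := null_mod0 (nc t); split; rewrite ?central_br ?central_pm.
- have [x0 fx] := null_mod0 nx.
  have -> : e' = e.
    apply: val_inj; rewrite /= defe defe'; apply/eqP; rewrite eqEsubv !subv_add.
    rewrite !addvSr !andbT -!memvE; move: xy; rewrite add0v => /vlineP[s defy].
    have yE : y = a *: x + s *: z by rewrite -defy addrC subrK.
    apply/andP; split; first by rewrite yE memv_add ?memvZ ?memv_line.
    rewrite -[x](scalerK a0) memvZ //.
    have -> : a *: x = y + (- s) *: z by rewrite yE scaleNr addrK.
    by rewrite memv_add ?memvZ ?memv_line.
  apply: connected_component_refl.
  by apply: E2_pair defe _ x0 central_pm; rewrite central_br.
- by apply: connected_component_sym; apply: IH.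
- have [_ /null_mod0[y0 fy]] := linked_null xy.
  have [e1 defe1] := exists_Gr2 fy.
  exact: connected_component_trans (IHx _ _ defe defe1) (IHy _ _ defe1 defe').
Qed.

(** If e = <x, b> does not contain z, then <x, (1 - t) b + t z> is a plane for
    every t: z would be in e if (1 - t) b + t z were a multiple of x, t <> 0. *)
Lemma component_through_center (e : Gr2 u) : E2 br pm e ->
  exists2 x, null_mod pm 0%VS z x & forall e' : Gr2 u,
    gr2_val e' = (<[x]> + <[z]>)%VS -> connected_component (E2 br pm) e e'.
Proof.
move=> Ee; have [ab pm0e] := Ee.
have z0 : z != 0 by rewrite -memv0 (cn_notin cnz).
have [ze|ze] := boolP (z \in gr2_val e).
  have [x [xe fx defe]] := gr2_complete_basis ze z0.
  exists x => [|e' defe'].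
    split; rewrite ?memv0 ?pm0e // add0v.
    by move: fx; rewrite free_pair => /andP[].
  have -> : e' = e by apply: val_inj; rewrite /= defe defe'.
  exact: connected_component_refl.
have [b be b0] : exists2 b, b \in gr2_val e & b != 0.
  exists (vpick (gr2_val e)); first exact: memv_pick.
  by rewrite vpick0 -dimv_eq0; case: (e) => W /= /eqP->.
have [x [xe]] := gr2_complete_basis be b0.
rewrite free_pair => /andP[xb _] defe; have x0 : x != 0.
  by apply: contraNneq xb => ->; rewrite mem0v.
have xz : x \notin <[z]>%VS.
  apply: contra ze => /vlineP[s xE]; have s0 : s != 0.
    by apply: contraNneq x0 => s0; rewrite xE s0 scale0r.
  by rewrite -[z](scalerK s0) -xE memvZ.
exists x => [|e' defe']; first by split; rewrite ?memv0 ?pm0e // add0v.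
apply: (component_pencil_curve (polycurve_line b z) (polycurve_cst x)).
- move=> t; split; last exact: pm0e.
  + rewrite free_pair x0 andbT; have [->|t0] := eqVneq t 0.
      rewrite subr0 scale1r scale0r addr0; apply: contra xb => /vlineP[s bE].
      have s0 : s != 0 by apply: contraNneq b0 => s0; rewrite bE s0 scale0r.
      by apply/vlineP; exists s^-1; rewrite bE scalerK.
    apply: contra ze => tz; rewrite -[z](scalerK t0) memvZ //.
    rewrite -(addKr ((1 - t) *: b) (t *: z)) memvD ?memvN ?memvZ //.
    by apply: (subvP _ _ tz); rewrite -memvE.
  + rewrite (brDl restr_u) !(brZl restr_u) ab // (brC restr_u z) central_br.
    by rewrite oppr0 !scaler0 addr0.
  + rewrite pmD_commuting; last by rewrite (brZr restr_u) central_br scaler0.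
    by rewrite !(pmapZ (proj2 restr_u)) central_pm pm0e // !scaler0 addr0.
- by rewrite defe subr0 scale1r scale0r addr0 addvC.
- by rewrite defe' subrr scale0r scale1r add0r addvC.
Qed.

End ConnectednessOfE2.

Theorem theoremA (k : closedFieldType) (p : nat) (u : vectType k)
    (br : u -> u -> u) (pm : u -> u)
    (charkp : p \in [pchar k]%R) (p_ge3 : 3 <= p)
    (restr_u : is_restricted_lie p br pm)
    (unip_u : unipotent pm) :
  connected (E2 br pm).
Proof.
have [[e0 Ee0]|hE] := pselect (exists e, E2 br pm e); last first.
  rewrite (_ : E2 br pm = set0)%classic; first exact: connected0.
  by apply/seteqP; split=> // e Ee; case: hE; exists e.
have [|z cnz] := exists_central_null p_ge3 restr_u unip_u.
  case: e0 Ee0 => W /= /eqP dimW _.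
  by apply: leq_trans (dimvS (subvf W)); rewrite dimW.
have joined e : E2 br pm e -> connected_component (E2 br pm) e0 e.
  move=> Ee.
  have [x nx hx] := component_through_center p_ge3 cnz Ee0.
  have [y ny hy] := component_through_center p_ge3 cnz Ee.
  have [ex defex] := exists_Gr2 (proj2 (null_mod0 cnz nx)).
  have [ey defey] := exists_Gr2 (proj2 (null_mod0 cnz ny)).
  have lxy := all_null_mod_linked p_ge3 unip_u cnz nx ny.
  have hxy := component_linked p_ge3 cnz lxy defex defey.
  apply: connected_component_trans (hx _ defex) _.
  exact/(connected_component_trans hxy)/connected_component_sym/hy.
suff -> : E2 br pm = connected_component (E2 br pm) e0.
  exact: component_connected.
by apply/seteqP; split=> //; apply: connected_component_sub.
Qed.
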